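(* Let $(p_n)_{n\ge 0}$ be the polynomials determined by $p_0(x)=1$ and $xp_n(x)=\gamma_np_{n+1}(x)+\alpha_np_{n-1}(x)$ for $n\ge 0$, where $\alpha_0=0$, $\gamma_0=1$, and $\alpha_n>0$, $\gamma_n>0$, $\alpha_n+\gamma_n=1$ for $n\ge 1$. Assume that $(\alpha_n)_{n\ge0}$ is increasing, $\alpha_n\le 1/2$ for all $n$, and $$\alpha_n-\alpha_{n-1}\ge \frac{\alpha_n}{1-\alpha_n}(\alpha_{n+1}-\alpha_n),\quad n\ge 1.$$ Let $q_n(x)=\frac{p_{n+2}(x)-p_n(x)}{x^2-1}$ for $n\ge0$. Then for all $n\ge1$ and $-1<x<1$ $$\frac{q_n^2(x)}{q_n^2(1)}-\frac{q_{n-1}(x)}{q_{n-1}(1)}\,\frac{q_{n+1}(x)}{q_{n+1}(1)}\ge 0.$$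
   Context: ''Increasing'' is meant in the weak sense. Since $\gamma_0=1$ we have $p_n(1)=1$, $p_n(-1)=(-1)^n$, so $q_n$ is a polynomial (of degree $n$). The $q_n$ are orthogonal with respect to $(1-x^2)\,d\mu(x)$, where $\mu$ is the orthogonality measure of $(p_n)$, supported in $[-1,1]$; in particular $q_n(1)>0$. *)

(* Defs.v *)
From HB Require Import structures.
From mathcomp Require Import all_boot all_order all_algebra.
From mathcomp Require Import reals.
From mathcomp Require Import ring.

Set Implicit Arguments.
Unset Strict Implicit.
Unset Printing Implicit Defensive.

Import Order.TTheory GRing.Theory Num.Theory.
Local Open Scope ring_scope.

(* At n = 0 the index n - 1 reads n.-1 = 0; that term is multiplied by
   alpha 0, which is 0 in all uses. *)
Definition three_term_recurrence (R : realType) (alpha gamma : nat -> R)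
    (p : nat -> {poly R}) : Prop :=
  p 0%N = 1 /\
  forall n : nat, 'X * p n = gamma n *: p n.+1 + alpha n *: p n.-1.

(* Euclidean quotient of polynomials; the division is exact under the
   hypotheses of q_ofE below. *)
Definition q_of (R : realType) (p : nat -> {poly R}) (n : nat) : {poly R} :=
  (p n.+2 - p n) %/ ('X^2 - 1).

Section Exactness.
Variables (R : realType) (alpha gamma : nat -> R) (p : nat -> {poly R}).
Hypothesis alpha0 : alpha 0%N = 0.
Hypothesis gamma0 : gamma 0%N = 1.
Hypothesis gamma_gt0 : forall n, (1 <= n)%N -> 0 < gamma n.
Hypothesis alphaDgamma : forall n, (1 <= n)%N -> alpha n + gamma n = 1.
Hypothesis rec_p : three_term_recurrence alpha gamma p.

Lemma p_at_sign (e : R) : e * e = 1 -> forall n, (p n).[e] = e ^+ n.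
Proof.
move=> ee; case: rec_p => p0 rec n.
suff: (p n).[e] = e ^+ n /\ (p n.+1).[e] = e ^+ n.+1 by case.
elim: n => [|n [IH1 IH2]].
  split; first by rewrite p0 hornerE.
  have := congr1 (fun r => r.[e]) (rec 0%N).
  by rewrite /= p0 alpha0 gamma0 scale0r addr0 scale1r mulr1 hornerX expr1.
split=> //.
have := congr1 (fun r => r.[e]) (rec n.+1).
rewrite /= hornerM hornerX hornerD !hornerZ IH1 IH2 => E.
have g0 : gamma n.+1 != 0 by rewrite gt_eqF ?gamma_gt0.
apply: (mulfI g0); apply: (addIr (alpha n.+1 * e ^+ n)); rewrite -E.
have -> : e ^+ n.+2 = e ^+ n by rewrite !exprS mulrA ee mul1r.
by rewrite -mulrDl [gamma _ + _]addrC alphaDgamma // mul1r exprS mulrA ee mul1r.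
Qed.

Lemma q_ofE (n : nat) : q_of p n * ('X^2 - 1) = p n.+2 - p n.
Proof.
apply: divpK.
have rt (e : R) : e * e = 1 -> root (p n.+2 - p n) e.
  move=> ee; rewrite /root !hornerE !(p_at_sign ee).
  by rewrite !exprS mulrA ee mul1r subrr.
have -> : 'X^2 - 1 = ('X - 1%:P) * ('X - (-1)%:P) :> {poly R}.
  by rewrite rmorphN rmorph1; ring.
rewrite Gauss_dvdp ?dvdp_XsubCl ?rt ?mulr1 ?mulrNN ?mulr1 //.
rewrite coprimep_XsubC root_XsubC.
by rewrite -subr_eq0 -opprD oppr_eq0 -(natrD _ 1 1) pnatr_eq0.
Qed.

End Exactness.

(* Main.v *)
Require Import Defs.
From mathcomp Require Import all_boot all_order all_algebra.
From mathcomp Require Import reals.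
From mathcomp Require Import ring lra.

Import Order.TTheory GRing.Theory Num.Theory.
Local Open Scope ring_scope.

(** The quotients satisfy x q_n = gamma_{n+2} q_{n+1} + alpha_n q_{n-1}.  Hence
    Q_n = q_n / q_n(1) satisfies x Q_n = (1 - a_n) Q_{n+1} + a_n Q_{n-1} with
    a_0 = 0 and a_{n+1} (1 - a_n) = alpha_{n+1} gamma_{n+2}.  The hypothesis on
    the differences of alpha says exactly that alpha_n gamma_{n+1} is increasing,
    and it is at most 1/4; so a_n is increasing and at most 1/2.  For such
    recurrences the Turan determinants D_n = Q_n^2 - Q_{n-1} Q_{n+1} satisfy
      (1 - a_n) D_n = (1 - a_n) Q_n^2 + a_n Q_{n-1}^2 - x Q_{n-1} Q_n
                    = a_{n-1} D_{n-1} + (a_n - a_{n-1}) (Q_{n-1}^2 - Q_n^2).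
    The first expression is nonnegative when Q_n^2 >= Q_{n-1}^2, the second one,
    by induction, when Q_n^2 <= Q_{n-1}^2. *)

Lemma turan_ge0 (R : realFieldType) (a Q : nat -> R) (x : R)
    (a0 : a 0%N = 0) (a_incr : forall n, a n <= a n.+1)
    (a_le_half : forall n, a n <= 1 / 2) (x_itv : -1 <= x <= 1)
    (rec_Q : forall n, x * Q n = (1 - a n) * Q n.+1 + a n * Q n.-1) (n : nat) :
  0 <= Q n.+1 ^+ 2 - Q n * Q n.+2.
Proof.
have a_ge0 k : 0 <= a k by elim: k => [|k IH];
  [rewrite a0 | apply: le_trans (a_incr k)].
have det k : (1 - a k.+1) * (Q k.+1 ^+ 2 - Q k * Q k.+2) =
    (1 - a k.+1) * Q k.+1 ^+ 2 + a k.+1 * Q k ^+ 2 - x * Q k.+1 * Q k.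
  by rewrite (rec_Q k.+1) /=; ring.
have step k : (1 - a k.+1) * (Q k.+1 ^+ 2 - Q k * Q k.+2) =
    a k * (Q k ^+ 2 - Q k.-1 * Q k.+1) + (a k.+1 - a k) * (Q k ^+ 2 - Q k.+1 ^+ 2).
  have -> : a k * (Q k ^+ 2 - Q k.-1 * Q k.+1) =
      (1 - a k) * Q k.+1 ^+ 2 + a k * Q k ^+ 2 - x * Q k * Q k.+1.
    by rewrite (rec_Q k); ring.
  by rewrite det; ring.
(* The factor [a k] lets the induction start at [k = 0], where [a 0 = 0] removes the term in
   [Q k.-1]. *)
have main k : 0 <= a k * (Q k ^+ 2 - Q k.-1 * Q k.+1) ->
    0 <= Q k.+1 ^+ 2 - Q k * Q k.+2.
  move=> IH; have half := a_le_half k.+1.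
  have gt0 : 0 < 1 - a k.+1 by lra.
  rewrite -(pmulr_rge0 _ gt0).
  have [le_Q|/ltW le_Q] := lerP (Q k.+1 ^+ 2) (Q k ^+ 2).
    by rewrite step addr_ge0 // mulr_ge0 // subr_ge0.
  rewrite det; case/andP: x_itv => x_ge x_le.
  have xQ : x * Q k.+1 * Q k <= (Q k.+1 ^+ 2 + Q k ^+ 2) / 2.
    have : 0 <= (1 - x) * (Q k.+1 + Q k) ^+ 2 by rewrite mulr_ge0 ?sqr_ge0 ?subr_ge0.
    have : 0 <= (1 + x) * (Q k.+1 - Q k) ^+ 2 by rewrite mulr_ge0 ?sqr_ge0 //; lra.
    by lra.
  (* With [xQ], the difference is at least [(1/2 - a k.+1) * (Q k.+1 ^+ 2 - Q k ^+ 2)]. *)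
  by nra.
elim: n => [|n IH]; apply: main; first by rewrite a0 mul0r.
exact: mulr_ge0.
Qed.

Section Quotients.
Context {R : realType} {alpha gamma : nat -> R} {p : nat -> {poly R}}.
Hypothesis alpha0 : alpha 0%N = 0.
Hypothesis gamma0 : gamma 0%N = 1.
Hypothesis gamma_gt0 : forall n, (1 <= n)%N -> 0 < gamma n.
Hypothesis alphaDgamma : forall n, (1 <= n)%N -> alpha n + gamma n = 1.
Hypothesis rec_p : three_term_recurrence alpha gamma p.

Let alphaDgammaT n : alpha n + gamma n = 1.
Proof. by case: n => [|n]; [rewrite alpha0 gamma0 add0r | apply: alphaDgamma]. Qed.

Let rec_pT n :
  p n.+1 - 'X * p n = (alpha n)%:P * (p n.+1 - p n.-1) /\
  'X * p n - p n.-1 = (gamma n)%:P * (p n.+1 - p n.-1).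
Proof.
have gE : gamma n = 1 - alpha n by rewrite -(alphaDgammaT n) addrC addKr.
case: rec_p => _ /(_ n); rewrite -!mul_polyC gE rmorphB rmorph1 => ->.
by split; ring.
Qed.

Let X2B1_neq0 : 'X^2 - 1 != 0 :> {poly R}.
Proof. by rewrite -size_poly_eq0 -[1]/(1%:P) size_XnsubC. Qed.

(** The factor [alpha n] vanishes at [n = 0], where [n.-1] is not a genuine predecessor. *)
Let alpha_qE n :
  (alpha n)%:P * q_of p n.-1 * ('X^2 - 1) = p n.+1 - 'X * p n.
Proof.
case: n => [|n]; first by rewrite (rec_pT 0).1 alpha0 !mul0r.
by rewrite -mulrA (q_ofE alpha0 gamma0 gamma_gt0 alphaDgamma rec_p) (rec_pT n.+1).1.
Qed.

Let gamma_qE n :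
  (gamma n.+1)%:P * q_of p n * ('X^2 - 1) = 'X * p n.+1 - p n.
Proof.
by rewrite -mulrA (q_ofE alpha0 gamma0 gamma_gt0 alphaDgamma rec_p) (rec_pT n.+1).2.
Qed.

(** Evaluated at 1, where [p n] takes the value 1, this yields the positivity of the normalizing
    constants by induction. *)
Lemma gamma_q_of n :
  (gamma n.+1)%:P * q_of p n = p n + 'X * ((alpha n)%:P * q_of p n.-1).
Proof.
apply: (mulIf X2B1_neq0); rewrite gamma_qE mulrDl -mulrA alpha_qE; ring.
Qed.

(** After multiplication by ['X^2 - 1], the two terms on the right contain [p n.+1] with opposite
    signs, leaving ['X * (p n.+2 - p n)]. *)
Lemma q_of_rec n :
  'X * q_of p n = (gamma n.+2)%:P * q_of p n.+1 + (alpha n)%:P * q_of p n.-1.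
Proof.
apply: (mulIf X2B1_neq0); rewrite mulrDl gamma_qE alpha_qE -mulrA.
rewrite (q_ofE alpha0 gamma0 gamma_gt0 alphaDgamma rec_p); ring.
Qed.

Lemma q_of1_gt0 (alpha_ge0 : forall n, 0 <= alpha n) n : 0 < (q_of p n).[1].
Proof.
have E k : gamma k.+1 * (q_of p k).[1] = 1 + alpha k * (q_of p k.-1).[1].
  have /(congr1 (horner^~ 1)) := gamma_q_of k.
  rewrite !hornerE (p_at_sign alpha0 gamma0 gamma_gt0 alphaDgamma rec_p) ?mulr1 //.
  by rewrite expr1n.
elim: n => [|n IH].
  by rewrite -(pmulr_rgt0 _ (gamma_gt0 1 isT)) E alpha0 mul0r addr0.
rewrite -(pmulr_rgt0 _ (gamma_gt0 n.+2 isT)) E.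
by rewrite ltr_wpDr // mulr_ge0 // ltW.
Qed.

End Quotients.

Theorem proposition2p11 (R : realType) (alpha gamma : nat -> R)
    (p : nat -> {poly R})
    (alpha0 : alpha 0%N = 0) (gamma0 : gamma 0%N = 1)
    (alpha_gt0 : forall n : nat, (1 <= n)%N -> 0 < alpha n)
    (gamma_gt0 : forall n : nat, (1 <= n)%N -> 0 < gamma n)
    (alphaDgamma : forall n : nat, (1 <= n)%N -> alpha n + gamma n = 1)
    (rec_p : three_term_recurrence alpha gamma p)
    (alpha_incr : forall m n : nat, (m <= n)%N -> alpha m <= alpha n)
    (alpha_le_half : forall n : nat, alpha n <= 1 / 2)
    (alpha_diff : forall n : nat, (1 <= n)%N ->
      alpha n - alpha n.-1 >=
        alpha n / (1 - alpha n) * (alpha n.+1 - alpha n)) :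
  forall (n : nat) (x : R), (1 <= n)%N -> -1 < x < 1 ->
    (q_of p n).[x] ^+ 2 / (q_of p n).[1] ^+ 2
      - ((q_of p n.-1).[x] / (q_of p n.-1).[1])
        * ((q_of p n.+1).[x] / (q_of p n.+1).[1]) >= 0.
Proof.
move=> n x n_gt0 /andP[x_gt x_lt].
have alpha_ge0 k : 0 <= alpha k by rewrite -alpha0 alpha_incr.
have gammaE k : gamma k.+1 = 1 - alpha k.+1.
  by rewrite -(alphaDgamma k.+1 isT) addrC addKr.
pose q y k := (q_of p k).[y].
have c_gt0 k : 0 < q 1 k by apply: q_of1_gt0 rec_p alpha_ge0 k.
have rec_q y k : y * q y k = gamma k.+2 * q y k.+1 + alpha k * q y k.-1.
  have /(congr1 (horner^~ y)) := q_of_rec alpha0 gamma0 gamma_gt0 alphaDgamma rec_p k.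
  by rewrite !hornerE.
pose a k := alpha k * q 1 k.-1 / q 1 k.
have a0 : a 0%N = 0 by rewrite /a alpha0 !mul0r.
(* The recurrence at [y = 1]: the normalized coefficients sum to 1. *)
have aBE k : 1 - a k = gamma k.+2 * q 1 k.+1 / q 1 k.
  have ck := lt0r_neq0 (c_gt0 k).
  by apply: (mulIf ck); rewrite mulrBl /a !divfK // rec_q addrK.
have a_rec k : a k.+1 * (1 - a k) = alpha k.+1 * gamma k.+2.
  by rewrite aBE /a /=; field; rewrite !gt_eqF.
(* In [a_rec] the right side is at most [alpha k.+1 * (1 - alpha k.+1) <= 1/4], while
   [1 - a k >= 1/2] by induction. *)
have a_le_half k : a k <= 1 / 2.
  elim: k => [|k IH]; first by rewrite a0; lra.
  have := a_rec k; rewrite gammaE.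
  have := alpha_incr k.+1 k.+2 (leqnSn _); have := alpha_le_half k.+1.
  have := alpha_ge0 k.+1; nra.
have prod_incr k : alpha k * gamma k.+1 <= alpha k.+1 * gamma k.+2.
  have lt1 : 0 < 1 - alpha k.+1 by rewrite -gammaE gamma_gt0.
  have := alpha_diff k.+1 isT.
  rewrite /= mulrAC ler_pdivrMr // !gammaE; nra.
have a_ge0 k : 0 <= a k by rewrite divr_ge0 ?mulr_ge0 // ltW.
(* By induction [1 - a k.+1 <= 1 - a k], so [a k.+1 * (1 - a k.+1) <= a k.+1 * (1 - a k) <= a k.+2 *
   (1 - a k.+1)]; then the common positive factor cancels. *)
have a_incr k : a k <= a k.+1.
  elim: k => [|k IH]; first by rewrite a0.
  have := prod_incr k.+1; rewrite -!a_rec.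
  have gt0 : 0 < 1 - a k.+1 by have := a_le_half k.+1; lra.
  move=> le_prod; rewrite -(ler_pM2r gt0); apply: le_trans le_prod.
  by rewrite ler_wpM2l // lerB.
case: n n_gt0 => // n _ /=.
have := @turan_ge0 _ a (fun k => q x k / q 1 k) x a0 a_incr a_le_half _ _ n.
rewrite expr_div_n; apply; first by rewrite !ltW.
move=> k; rewrite aBE /a mulrA rec_q.
by field; rewrite !gt_eqF.
Qed.
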